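(* Let $k$ be a field, $R=k[x_1,\dots,x_n]$, let $M$ be an $\varepsilon$-straight $R$-module and let $\{F_j\}_{0\le j\le n}$ be an increasing filtration of $M$ by $\varepsilon$-straight submodules with $F_n=M$ such that for all $1\le j\le n$ there are graded isomorphisms $$F_j/F_{j-1}\simeq\bigoplus_{\alpha\in\Omega,\ |\alpha|=j}\bigl(H^j_{\mathfrak{p}_\alpha}(R)\bigr)^{\oplus\, m_\alpha},\qquad m_\alpha=\dim_k M_\alpha .$$ For $1\le j\le n$, let $(s_j)$ denote the extension $$0\to F_{j-1}\to F_j\to F_j/F_{j-1}\to 0 .$$ Then the extension class of $(s_j)$ in ${}^{\ast}\mathrm{Ext}^1_R(F_j/F_{j-1},F_{j-1})$ is uniquely determined by the $k$-linear maps $$\cdot x_i: M_\alpha\to M_{\alpha+\varepsilon_i},\qquad \alpha\in\Omega,\ |\alpha|=j,\ \alpha_i=-1 .$$ That is: if $0\to F_{j-1}\to E\to F_j/F_{j-1}\to 0$ is any extension of graded $R$-modules such that for all $\alpha\in\Omega$ with $|\alpha|=j$ and all $i$ with $\alpha_i=-1$ the map $\cdot x_i:E_\alpha\to E_{\alpha+\varepsilon_i}$ coincides with $\cdot x_i:M_\alpha\to M_{\alpha+\varepsilon_i}$ under the canonical identifications $E_\alpha= (F_j/F_{j-1})_\alpha=M_\alpha$ and $E_{\alpha+\varepsilon_i}=(F_{j-1})_{\alpha+\varepsilon_i}=M_{\alpha+\varepsilon_i}$ given by the extension and the filtration, then its class equals the class of $(s_j)$.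
   Context: $R$ is $\mathbb{Z}^n$-graded by $\deg(x_i)=\varepsilon_i$ (canonical basis of $\mathbb{Z}^n$); ''graded'' means $\mathbb{Z}^n$-graded. ${}^{\ast}\mathrm{Mod}_R$ is the category of graded $R$-modules with degree-preserving morphisms, and ${}^{\ast}\mathrm{Ext}^i_R$ denotes $\mathrm{Ext}$ in this category. For a graded module $M$ and $\alpha\in\mathbb{Z}^n$, $M(\alpha)_\beta=M_{\alpha+\beta}$. For $\alpha\in\mathbb{Z}^n$, $x^\alpha=x_1^{\alpha_1}\cdots x_n^{\alpha_n}$ and $\mathrm{supp}_+(\alpha)=\{i\mid\alpha_i>0\}$. A graded module $M$ is straight if (i) $\dim_kM_\alpha<\infty$ for all $\alpha\in\mathbb{Z}^n$, and (ii) the multiplication map $M_\alpha\to M_{\alpha+\beta}$, $y\mapsto x^\beta y$, is bijective for all $\alpha\in\mathbb{Z}^n$, $\beta\in\mathbb{N}^n$ with $\mathrm{supp}_+(\alpha+\beta)=\mathrm{supp}_+(\alpha)$. With $\varepsilon=(-1,\dots,-1)$, $M$ is $\varepsilon$-straight if $M(\varepsilon)$ is straight. $\Omega=\{-1,0\}^n$; for $\alpha\in\Omega$, $|\alpha|=\sum|\alpha_i|$ and $\mathfrak{p}_\alpha=\langle x_i\mid\alpha_i=-1\rangle$. The local cohomology modules $H^j_{\mathfrak{p}_\alpha}(R)$ carry their natural $\mathbb{Z}^n$-grading. *)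

(* Defs.v *)
From HB Require Import structures.
From mathcomp Require Import all_boot all_order all_algebra.
From mathcomp Require Import boolp.
From mathcomp Require Import mpoly.

Set Implicit Arguments.
Unset Strict Implicit.
Unset Printing Implicit Defensive.

Import GRing.Theory.
Local Open Scope ring_scope.
Local Open Scope quotient_scope.

Definition Zn (n : nat) := {ffun 'I_n -> int}.

Definition mdegZ (n : nat) (m : 'X_{1..n}) : Zn n := [ffun i => (m i)%:Z].

(* f is homogeneous of degree a, i.e. f is a k-multiple of x^a. *)
Definition homogeneous (k : fieldType) (n : nat) (a : Zn n) (f : {mpoly k[n]}) : Prop :=
  forall m, m \in msupp f -> mdegZ m = a.

Lemma sum_ext (T : eqType) (V : nmodType) (t t' : seq T) (h : T -> V) :
  uniq t -> uniq t' -> {subset t <= t'} ->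
  \sum_(a <- t') (if a \in t then h a else 0) = \sum_(a <- t) h a.
Proof.
move=> ut ut' tt'; rewrite -big_mkcond -big_filter; apply: perm_big.
apply: uniq_perm; rewrite ?filter_uniq // => a; rewrite mem_filter.
by case at_: (a \in t) => //=; rewrite (tt' a at_).
Qed.

Section Grading.
Variables (k : fieldType) (n : nat) (M : lmodType {mpoly k[n]}).
Variable deg : Zn n -> M -> Prop.

(* x is a finite sum of homogeneous elements, of distinct degrees, in P. *)
Definition homog_sum (P : M -> Prop) (x : M) : Prop :=
  exists (s : seq (Zn n)) (c : Zn n -> M),
    [/\ uniq s, forall a, deg a (c a) /\ P (c a) & x = \sum_(a <- s) c a].

(* M is the direct sum of the M_a = {x | deg a x}, and R_b M_a is included
   in M_(a + b). *)
Record grading : Prop := Grading {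
  grading0 : forall a, deg a 0;
  gradingB : forall a x y, deg a x -> deg a y -> deg a (x - y);
  gradingZ : forall a b f x, homogeneous b f -> deg a x -> deg (a + b) (f *: x);
  grading_sum : forall x, homog_sum (fun=> True) x;
  grading_uniq : forall (s : seq (Zn n)) (c : Zn n -> M),
    uniq s -> (forall a, deg a (c a)) -> \sum_(a <- s) c a = 0 ->
    forall a, a \in s -> c a = 0
}.

End Grading.

Record grMod (k : fieldType) (n : nat) := GrMod {
  gcar :> lmodType {mpoly k[n]};
  gdeg : Zn n -> gcar -> Prop;
  gdegP : grading gdeg
}.
Arguments gdeg {k n} _ _ _.

Record grHom (k : fieldType) (n : nat) (A B : grMod k n) := GrHom {
  ghom :> {linear A -> B};
  ghom_deg : forall a x, gdeg A a x -> gdeg B a (ghom x)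
}.

Definition grIso (k : fieldType) (n : nat) (A B : grMod k n) : Prop :=
  exists f : grHom A B, bijective f.

Section Shift.
Variables (k : fieldType) (n : nat) (M : grMod k n) (a : Zn n).

Definition shift_deg (b : Zn n) (x : M) : Prop := gdeg M (a + b) x.

Lemma shift_grading : grading shift_deg.
Proof.
have [h0 hB hZ hs hu] := gdegP M; split.
- by move=> b; apply: h0.
- by move=> b x y; apply: hB.
- by move=> b c f x hf hx; rewrite /shift_deg addrA; apply: hZ.
- move=> x; have [s [c [us cP ->]]] := hs x.
  exists [seq b - a | b <- s], (fun b => c (a + b)); split.
  + by rewrite map_inj_uniq // => b b'; apply: addIr.
  + by move=> b; split=> //; apply: (cP (a + b)).1.
  + by rewrite big_map; apply: eq_bigr => b _; rewrite addrC subrK.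
- move=> s c us cP sc0 b bs.
  have := hu [seq a + b | b <- s] (fun b => c (b - a)).
  rewrite map_inj_uniq; last exact: addrI.
  move=> /(_ us); rewrite big_map => H.
  have := H _ _ (a + b); rewrite [a + b - a]addrC addKr; apply.
  + by move=> b'; have := cP (b' - a); rewrite /shift_deg addrC subrK.
  + by rewrite -[RHS]sc0; apply: eq_bigr => b' _; rewrite [a + b' - a]addrC addKr.
  + by rewrite mem_map //; apply: addrI.
Qed.

Definition grShift : grMod k n := GrMod shift_grading.

End Shift.

Record grSub (k : fieldType) (n : nat) (M : grMod k n) := GrSub {
  gsub :> {pred M};
  gsub_closed : submod_closed gsub;
  gsub_homog : forall x, x \in gsub ->
    homog_sum (gdeg M) (fun y => y \in gsub) x
}.

(* The coercion of a [grSub] to a predicate, in the form [M -> bool] that the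
   closedness structures of the library are keyed on. *)
Definition gsmem (k : fieldType) (n : nat) (M : grMod k n) (N : grSub M) :
  M -> bool := fun x => x \in N.

HB.instance Definition _ (k : fieldType) (n : nat) (M : grMod k n) (N : grSub M) :=
  GRing.isSubmodClosed.Build _ _ (gsmem N) (gsub_closed N).

Section SubModule.
Variables (k : fieldType) (n : nat) (M : grMod k n) (N : grSub M).

Record sub_type := SubElt { sub_val :> M; _ : gsmem N sub_val }.

HB.instance Definition _ := [isSub for sub_val].
HB.instance Definition _ := [Choice of sub_type by <:].
HB.instance Definition _ := [SubChoice_isSubLmodule of sub_type by <:].

Lemma sub_val_sum (I : Type) (s : seq I) (F : I -> sub_type) :
  sub_val (\sum_(i <- s) F i) = \sum_(i <- s) sub_val (F i).
Proof. exact: (raddf_sum (val : sub_type -> M)). Qed.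

Definition sub_deg (a : Zn n) (x : sub_type) : Prop := gdeg M a (sub_val x).

Lemma sub_grading : grading sub_deg.
Proof.
have [h0 hB hZ hs hu] := gdegP M; split.
- by move=> b; apply: h0.
- by move=> b x y; apply: hB.
- by move=> b c f x; apply: hZ.
- move=> [x xN]; have [s [c [us cP xE]]] := gsub_homog xN.
  exists s, (fun a => SubElt (cP a).2); split => //.
  + by move=> a; split=> //; apply: (cP a).1.
  + by apply: val_inj => /=; rewrite sub_val_sum.
- move=> s c us cP sc0 b bs; apply: val_inj => /=.
  apply: (hu s (fun a => sub_val (c a))) => //.
  by rewrite -sub_val_sum sc0.
Qed.

Definition subGr : grMod k n := GrMod sub_grading.

End SubModule.

Section Quotient.
Variables (k : fieldType) (n : nat) (M : grMod k n) (N : grSub M).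

Definition gszmod : zmodClosed M := GRing.ZmodClosed.clone M (gsmem N) _.

Definition quot_type := Quotient.quot gszmod.

HB.instance Definition _ := GRing.Zmodule.on quot_type.

Definition quot_pi (x : M) : quot_type := \pi_(Quotient.quot gszmod) x.

Lemma quot_piP (x y : M) : quot_pi x = quot_pi y <-> x - y \in N.
Proof.
by rewrite -[_ \in N]/(x - y \in gszmod) (Quotient.idealrBE gszmod);
   split=> /eqP.
Qed.

Lemma quot_piB : zmod_morphism quot_pi.
Proof. by move=> x y; rewrite /quot_pi raddfB. Qed.

Lemma quot_repr (x : quot_type) : quot_pi (repr x) = x.
Proof. exact: reprK. Qed.

HB.instance Definition _ :=
  GRing.isZmodMorphism.Build _ _ quot_pi quot_piB.

Definition quot_scale (f : {mpoly k[n]}) (x : quot_type) : quot_type :=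
  quot_pi (f *: repr x).

Lemma quot_scaleE f x : quot_scale f (quot_pi x) = quot_pi (f *: x).
Proof.
apply/quot_piP; rewrite -scalerBr.
have : repr (quot_pi x) - x \in gsmem N by apply/quot_piP; rewrite quot_repr.
exact: rpredZ.
Qed.

Lemma quot_scaleA a b v : quot_scale a (quot_scale b v) = quot_scale (a * b) v.
Proof. by rewrite -[v]quot_repr !quot_scaleE scalerA. Qed.

Lemma quot_scale1 : left_id 1 quot_scale.
Proof. by move=> v; rewrite -[v]quot_repr !quot_scaleE scale1r. Qed.

Lemma quot_scaleDr : right_distributive quot_scale +%R.
Proof.
move=> a u v; rewrite -[u]quot_repr -[v]quot_repr.
by rewrite -(raddfD quot_pi) !quot_scaleE scalerDr (raddfD quot_pi).
Qed.

Lemma quot_scaleDl v : {morph quot_scale^~ v : a b / a + b}.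
Proof.
by move=> a b /=; rewrite -[v]quot_repr !quot_scaleE scalerDl (raddfD quot_pi).
Qed.

HB.instance Definition _ := GRing.Zmodule_isLmodule.Build _ quot_type
  quot_scaleA quot_scale1 quot_scaleDr quot_scaleDl.

Lemma quot_piZ : scalable quot_pi.
Proof. by move=> f x; rewrite -quot_scaleE. Qed.

HB.instance Definition _ :=
  GRing.isScalable.Build _ _ _ _ quot_pi quot_piZ.

Definition quot_deg (a : Zn n) (x : quot_type) : Prop :=
  exists2 y, gdeg M a y & x = quot_pi y.

Lemma quot_grading : grading quot_deg.
Proof.
have [h0 hB hZ hs hu] := gdegP M; split.
- by move=> b; exists 0; rewrite ?raddf0.
- move=> b _ _ [x xb ->] [y yb ->]; exists (x - y); first exact: hB.
  by rewrite raddfB.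
- move=> b c f _ hf [x xb ->]; exists (f *: x); first exact: hZ.
  by rewrite linearZ.
- move=> x; have [s [c [us cP xE]]] := hs (repr x).
  exists s, (fun a => quot_pi (c a)); split => //.
  + by move=> a; split=> //; exists (c a) => //; apply: (cP a).1.
  + by rewrite -(raddf_sum quot_pi) -xE; apply/esym/quot_repr.
- move=> s c us cP sc0 b bs.
  have /choice [f fP] : forall a, exists y, gdeg M a y /\ c a = quot_pi y.
    by move=> a; have [y] := cP a; exists y.
  have : \sum_(a <- s) f a \in N.
    rewrite -[\sum_(a <- s) f a]subr0; apply/quot_piP; rewrite raddf_sum raddf0.
    by rewrite -[RHS]sc0; apply: eq_bigr => a _; rewrite (fP a).2.
  move=> /gsub_homog [s' [g [us' gP fgE]]].
  pose ext (t : seq (Zn n)) (h : Zn n -> M) a := if a \in t then h a else 0.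
  pose t := undup (s ++ s').
  have /(_ b) : forall a, a \in t -> ext s f a - ext s' g a = 0.
    apply: (hu t (fun a => ext s f a - ext s' g a)); first exact: undup_uniq.
    + move=> a; apply: hB; rewrite /ext; case: ifP => // _; first exact: (fP a).1.
      exact: (gP a).1.
    + rewrite sumrB !sum_ext ?undup_uniq // ?fgE ?subrr // => a;
        by rewrite mem_undup mem_cat => ->; rewrite ?orbT.
  rewrite mem_undup mem_cat bs => /(_ isT) /eqP; rewrite subr_eq0 /ext bs => /eqP fE.
  rewrite (fP b).2 -[RHS](raddf0 quot_pi); apply/quot_piP; rewrite subr0 fE.
  by case: ifP => _; [exact: (gP b).2 | exact: (gsub_closed N).1].
Qed.

Definition quotGr : grMod k n := GrMod quot_grading.

Lemma quot_pi_deg a x : gdeg M a x -> gdeg quotGr a (quot_pi x).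
Proof. by exists x. Qed.

Definition quot_hom : grHom M quotGr :=
  @GrHom k n M quotGr quot_pi quot_pi_deg.

End Quotient.

(* The subquotient N / (N' :&: N): no inclusion of N' in N is required. *)

Section SubQuotient.
Variables (k : fieldType) (n : nat) (M : grMod k n) (N' N : grSub M).

Definition relsub_pred : {pred subGr N} := [pred x | sub_val x \in N'].

Lemma relsub_closed : submod_closed relsub_pred.
Proof.
have [N0 NZ] := gsub_closed N'; split; first exact: N0.
by move=> f x y; rewrite !inE; apply: NZ.
Qed.

Lemma relsub_homog x : x \in relsub_pred ->
  homog_sum (gdeg (subGr N)) (fun y => y \in relsub_pred) x.
Proof.
rewrite inE => /gsub_homog [s' [c' [us' cP' xE']]].
have [s [c [us cP xE]]] := grading_sum (gdegP (subGr N)) x.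
have [h0 hB hZ hs hu] := gdegP M.
pose d a := if a \in s then c a else 0; pose d' a := if a \in s' then c' a else 0.
pose t := undup (s ++ s').
have dd' a : a \in t -> sub_val (d a) - d' a = 0.
  apply: (hu t (fun a => sub_val (d a) - d' a)); first exact: undup_uniq.
  - move=> b; apply: hB; rewrite /d /d'.
    + by case: ifP => _; [exact: (cP b).1 | exact: h0].
    + by case: ifP => _; [exact: (cP' b).1 | exact: h0].
  - rewrite sumrB -sub_val_sum /d /d' !sum_ext ?undup_uniq // -?xE -?xE' ?subrr //;
      by move=> b; rewrite mem_undup mem_cat => ->; rewrite ?orbT.
exists s, d; split=> //.
- move=> a; split.
    by rewrite /d; case: ifP => _; [exact: (cP a).1 | exact: h0].
  rewrite inE; case as_: (a \in s); last first.
    by rewrite /d as_; exact: (gsub_closed N').1.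
  have /dd' /eqP : a \in t by rewrite mem_undup mem_cat as_.
  rewrite subr_eq0 => /eqP ->; rewrite /d'; case: ifP => _.
    exact: (cP' a).2.
  exact: (gsub_closed N').1.
- by rewrite /d sum_ext.
Qed.

Definition relsub : grSub (subGr N) := GrSub relsub_closed relsub_homog.

Definition subquot : grMod k n := quotGr relsub.

Definition subquot_pi : grHom (subGr N) subquot := quot_hom relsub.

End SubQuotient.

Section DirectSum.
Variables (k : fieldType) (n : nat) (I : finType) (X : I -> grMod k n).

Definition dsum_type := forall i, X i.

HB.instance Definition _ := gen_eqMixin dsum_type.
HB.instance Definition _ := gen_choiceMixin dsum_type.

Implicit Types x y z : dsum_type.

Definition dsum_add x y : dsum_type := fun i => x i + y i.
Definition dsum_opp x : dsum_type := fun i => - x i.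
Definition dsum_zero : dsum_type := fun i => 0.
Definition dsum_scale (f : {mpoly k[n]}) x : dsum_type := fun i => f *: x i.

Lemma dsum_addA : associative dsum_add.
Proof. by move=> x y z; apply: functional_extensionality_dep => i; apply: addrA. Qed.
Lemma dsum_addC : commutative dsum_add.
Proof. by move=> x y; apply: functional_extensionality_dep => i; apply: addrC. Qed.
Lemma dsum_add0 : left_id dsum_zero dsum_add.
Proof. by move=> x; apply: functional_extensionality_dep => i; apply: add0r. Qed.
Lemma dsum_addN : left_inverse dsum_zero dsum_opp dsum_add.
Proof. by move=> x; apply: functional_extensionality_dep => i; apply: addNr. Qed.

HB.instance Definition _ := GRing.isZmodule.Build dsum_type
  dsum_addA dsum_addC dsum_add0 dsum_addN.

Lemma dsum_scaleA a b x : dsum_scale a (dsum_scale b x) = dsum_scale (a * b) x.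
Proof. by apply: functional_extensionality_dep => i; apply: scalerA. Qed.
Lemma dsum_scale1 : left_id 1 dsum_scale.
Proof. by move=> x; apply: functional_extensionality_dep => i; apply: scale1r. Qed.
Lemma dsum_scaleDr : right_distributive dsum_scale +%R.
Proof. by move=> a x y; apply: functional_extensionality_dep => i; apply: scalerDr. Qed.
Lemma dsum_scaleDl x : {morph dsum_scale^~ x : a b / a + b}.
Proof. by move=> a b; apply: functional_extensionality_dep => i; apply: scalerDl. Qed.

HB.instance Definition _ := GRing.Zmodule_isLmodule.Build _ dsum_type
  dsum_scaleA dsum_scale1 dsum_scaleDr dsum_scaleDl.

Lemma dsum_sumE (J : Type) (s : seq J) (F : J -> dsum_type) i :
  (\sum_(j <- s) F j) i = \sum_(j <- s) F j i.
Proof. by elim/big_rec2: _ => // j y z _ <-. Qed.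

Definition dsum_deg (a : Zn n) x : Prop := forall i, gdeg (X i) a (x i).

Lemma dsum_grading : grading dsum_deg.
Proof.
split.
- by move=> a i; apply: (grading0 (gdegP (X i))).
- by move=> a x y hx hy i; apply: (gradingB (gdegP (X i))).
- by move=> a b f x hf hx i; apply: (gradingZ (gdegP (X i))).
- move=> x; pose P i := cid (grading_sum (gdegP (X i)) (x i)).
  pose s i := projT1 (P i); pose Q i := cid (projT2 (P i)).
  pose c i := projT1 (Q i); have cP i := projT2 (Q i).
  pose t := undup (flatten [seq s i | i : I]).
  exists t, (fun a i => if a \in s i then c i a else 0); split.
  + exact: undup_uniq.
  + move=> a; split=> // i; have [_ ciP _] := cP i; case: ifP => _.
      exact: (ciP a).1.
    exact: (grading0 (gdegP (X i))).
  + apply: functional_extensionality_dep => i; have [us _ ->] := cP i.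
    rewrite dsum_sumE sum_ext ?undup_uniq // => a ais.
    by rewrite mem_undup; apply/flatten_mapP; exists i; rewrite ?mem_enum.
- move=> s c us cP sc0 a as_; apply: functional_extensionality_dep => i.
  apply: (grading_uniq (gdegP (X i)) (c := fun a => c a i) us _ _ as_).
    by move=> b; apply: cP.
  by rewrite -dsum_sumE sc0.
Qed.

Definition dsumGr : grMod k n := GrMod dsum_grading.

End DirectSum.

Section Homogeneous.
Variables (k : fieldType) (n : nat).
Implicit Types (f g : {mpoly k[n]}) (a b : Zn n).

Lemma mdegZ_inj : injective (@mdegZ n).
Proof.
by move=> m m' /ffunP e; apply/mnmP => i; have := e i; rewrite !ffunE => -[].
Qed.

Lemma mdegZD m m' : mdegZ (m + m')%MM = mdegZ m + mdegZ m' :> Zn n.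
Proof. by apply/ffunP => i; rewrite !ffunE mnmDE PoszD. Qed.

Lemma mdegZ0 : mdegZ 0%MM = 0 :> Zn n.
Proof. by apply/ffunP => i; rewrite !ffunE mnm0E. Qed.

Lemma homogeneous0 a : homogeneous a (0 : {mpoly k[n]}).
Proof. by move=> m; rewrite msupp0. Qed.

Lemma homogeneousX m : homogeneous (mdegZ m) ('X_[m] : {mpoly k[n]}).
Proof. by move=> m'; rewrite msuppX inE => /eqP ->. Qed.

Lemma homogeneousB a f g : homogeneous a f -> homogeneous a g -> homogeneous a (f - g).
Proof.
by move=> hf hg m /msuppB_le; rewrite mem_cat => /orP[/hf|/hg].
Qed.

Lemma homogeneousM a b f g :
  homogeneous a f -> homogeneous b g -> homogeneous (a + b) (f * g).
Proof.
move=> hf hg m /msuppM_le /allpairsP [[m1 m2] /= [h1 h2 ->]].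
by rewrite mdegZD (hf _ h1) (hg _ h2).
Qed.

Lemma homogeneous_sum f : exists (s : seq (Zn n)) (c : Zn n -> {mpoly k[n]}),
  [/\ uniq s, forall a, homogeneous a (c a) & f = \sum_(a <- s) c a].
Proof.
exists [seq mdegZ m | m <- msupp f],
  (fun a => \sum_(m <- msupp f | mdegZ m == a) f@_m *: 'X_[m]); split.
- by rewrite map_inj_uniq ?msupp_uniq //; apply: mdegZ_inj.
- move=> a m'; apply: contraTeq => m'a; rewrite mcoeff_msupp negbK raddf_sum /=.
  rewrite big1 // => m /eqP ma; rewrite mcoeffZ mcoeffX.
  by case: (m =P m') m'a => [<-|_]; rewrite ?ma ?eqxx ?mulr0.
- rewrite big_map {1}[f]mpolyE; apply: eq_big_seq => m mf.
  rewrite -big_filter (@eq_in_filter _ _ (pred1 m)) => [|m' _ /=]; last first.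
    exact: inj_eq mdegZ_inj _ _.
  by rewrite filter_pred1_uniq ?msupp_uniq // big_seq1.
Qed.

Lemma homogeneous_uniq (s : seq (Zn n)) (c : Zn n -> {mpoly k[n]}) :
  uniq s -> (forall a, homogeneous a (c a)) -> \sum_(a <- s) c a = 0 ->
  forall a, a \in s -> c a = 0.
Proof.
move=> us cP sc0 a as_; apply/mpolyP => m; rewrite mcoeff0.
case: (eqVneq (mdegZ m) a) => [ma|ma]; last first.
  by apply/memN_msupp_eq0; apply: contra ma => /cP ->.
have := congr1 (mcoeff m) sc0; rewrite mcoeff0 raddf_sum /= (bigD1_seq a) //=.
rewrite big1 ?addr0 // => b ba; apply/memN_msupp_eq0.
by apply: contra ba => /cP <-; rewrite ma.
Qed.

End Homogeneous.

(* Fraction field of R = k[x_1, ..., x_n], as an R-module. *)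
Definition fracR (k : fieldType) (n : nat) := {fraction {mpoly k[n]}}.

Section FracR.
Variables (k : fieldType) (n : nat).

HB.instance Definition _ := GRing.Field.on (fracR k n).

Definition frac_scale (f : {mpoly k[n]}) (v : fracR k n) : fracR k n :=
  tofrac f * v.

Lemma frac_scaleA a b v : frac_scale a (frac_scale b v) = frac_scale (a * b) v.
Proof. by rewrite /frac_scale tofracM mulrA. Qed.
Lemma frac_scale1 : left_id 1 frac_scale.
Proof. by move=> v; rewrite /frac_scale tofrac1 mul1r. Qed.
Lemma frac_scaleDr : right_distributive frac_scale +%R.
Proof. by move=> a u v; rewrite /frac_scale mulrDr. Qed.
Lemma frac_scaleDl v : {morph frac_scale^~ v : a b / a + b}.
Proof. by move=> a b; rewrite /frac_scale tofracD mulrDl. Qed.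

HB.instance Definition _ := GRing.Zmodule_isLmodule.Build _ (fracR k n)
  frac_scaleA frac_scale1 frac_scaleDr frac_scaleDl.

End FracR.

(* The localization of R at x_T = \prod_(i in T) x_i, inside Frac(R). *)
Section Localization.
Variables (k : fieldType) (n : nat) (T : {set 'I_n}).

Definition monT : 'X_{1..n} := (\sum_(i in T) U_(i))%MM.

Definition xT : {mpoly k[n]} := \prod_(i in T) 'X_i.

Definition divxT (f : {mpoly k[n]}) (t : nat) : fracR k n :=
  tofrac f / tofrac (xT ^+ t).

Definition loc_pred (v : fracR k n) : bool := `[< exists f t, v = divxT f t >].

Lemma xTE : xT = 'X_[monT].
Proof. by rewrite /xT /monT mprodXE. Qed.

Lemma xT_neq0 t : tofrac (xT ^+ t) != 0.
Proof. by rewrite tofrac_eq0 expf_neq0 // xTE -msupp_eq0 msuppX. Qed.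

Lemma divxT_up f t s : divxT f t = divxT (f * xT ^+ s) (t + s).
Proof.
by rewrite /divxT exprD !tofracM -mulf_div divff ?mulr1 // xT_neq0.
Qed.

Lemma divxTB f g t : divxT (f - g) t = divxT f t - divxT g t.
Proof. by rewrite /divxT tofracB mulrBl. Qed.

Lemma divxTZ g f t : divxT (g * f) t = g *: divxT f t.
Proof. by rewrite /divxT tofracM -mulrA. Qed.

Lemma loc_closed : submod_closed (loc_pred : {pred fracR k n}).
Proof.
split; first by apply/asboolP; exists 0, 0; rewrite /divxT tofrac0 mul0r.
move=> a _ _ /asboolP [f [t ->]] /asboolP [g [s ->]]; apply/asboolP.
exists (a * (f * xT ^+ s) + g * xT ^+ t), (t + s)%N.
rewrite (divxT_up f t s) (divxT_up g s t) -divxTZ addnC.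
by rewrite -[in LHS](opprK (divxT (g * _) _)) /divxT -mulNr -tofracN -mulrBl
  -tofracB opprK.
Qed.

HB.instance Definition _ :=
  GRing.isSubmodClosed.Build _ _ loc_pred loc_closed.

Record loc_type := LocElt { loc_val :> fracR k n; _ : loc_pred loc_val }.

HB.instance Definition _ := [isSub for loc_val].
HB.instance Definition _ := [Choice of loc_type by <:].
HB.instance Definition _ := [SubChoice_isSubLmodule of loc_type by <:].

Definition loc_deg (a : Zn n) (v : loc_type) : Prop :=
  exists (f : {mpoly k[n]}) (t : nat),
    homogeneous (a + mdegZ monT *+ t) f /\ loc_val v = divxT f t.

Lemma loc_divxT f t : loc_pred (divxT f t).
Proof. by apply/asboolP; exists f, t. Qed.

Lemma homogeneous_xT a f s : homogeneous a f ->
  homogeneous (a + mdegZ monT *+ s) (f * xT ^+ s).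
Proof.
move=> hf; elim: s => [|s IHs]; first by rewrite mulr0n addr0 expr0 mulr1.
rewrite exprSr mulrA mulrSr addrA; apply: homogeneousM => //.
by rewrite xTE; apply: homogeneousX.
Qed.

Lemma loc_val_sum (I : Type) (s : seq I) (F : I -> loc_type) :
  loc_val (\sum_(i <- s) F i) = \sum_(i <- s) loc_val (F i).
Proof. exact: (raddf_sum (val : loc_type -> fracR k n)). Qed.

Lemma divxT_sum (I : Type) (s : seq I) (F : I -> {mpoly k[n]}) t :
  \sum_(i <- s) divxT (F i) t = divxT (\sum_(i <- s) F i) t.
Proof. by rewrite /divxT raddf_sum mulr_suml. Qed.

Lemma divxT_eq0 f t : (divxT f t == 0) = (f == 0).
Proof. by rewrite mulf_eq0 invr_eq0 (negPf (xT_neq0 t)) orbF tofrac_eq0. Qed.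

Lemma loc_grading : grading loc_deg.
Proof.
split.
- by move=> a; exists 0, 0; split; [exact: homogeneous0 | rewrite /divxT tofrac0 mul0r].
- move=> a x y [f [t [hf xE]]] [g [s [hg yE]]].
  exists (f * xT ^+ s - g * xT ^+ t), (t + s)%N; split.
    rewrite mulrnDr addrA; apply: homogeneousB; first exact: homogeneous_xT.
    by rewrite addrAC; apply: homogeneous_xT.
  rewrite divxTB -divxT_up [(t + s)%N]addnC -divxT_up -xE -yE.
  exact: (raddfB (val : loc_type -> fracR k n)).
- move=> a b f x hf [g [t [hg xE]]]; exists (f * g), t; split.
    by rewrite [a + b]addrC -addrA; apply: homogeneousM.
  by rewrite divxTZ -xE.
- move=> x; have /asboolP [f [t xE]] := valP x.
  have [s [c [us cP fE]]] := homogeneous_sum f.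
  exists [seq a - mdegZ monT *+ t | a <- s],
    (fun a => LocElt (loc_divxT (c (a + mdegZ monT *+ t)) t)); split.
  + by rewrite map_inj_uniq // => a b; apply: addIr.
  + by move=> a; split=> //; exists (c (a + mdegZ monT *+ t)), t.
  + apply: val_inj; rewrite [LHS]xE fE -divxT_sum [RHS]loc_val_sum big_map.
    by apply: eq_bigr => a _ /=; rewrite subrK.
- move=> s c us cP sc0 a as_.
  have /choice [p pP] : forall b, exists p : {mpoly k[n]} * nat,
      homogeneous (b + mdegZ monT *+ p.2) p.1 /\ loc_val (c b) = divxT p.1 p.2.
    by move=> b; have [f [t ?]] := cP b; exists (f, t).
  pose r := (\sum_(b <- s) (p b).2)%N.
  have rP b : b \in s -> ((p b).2 <= r)%N.
    by move=> bs; rewrite /r (big_rem b) //= leq_addr.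
  pose f b := (p b).1 * xT ^+ (r - (p b).2).
  have fP b : b \in s -> loc_val (c b) = divxT (f b) r.
    by move=> bs; rewrite (pP b).2 (divxT_up _ _ (r - (p b).2)) subnKC ?rP.
  pose u := mdegZ monT *+ r.
  have := @homogeneous_uniq k n [seq b + u | b <- s]
    (fun b => if b - u \in s then f (b - u) else 0).
  rewrite map_inj_uniq; last exact: addIr.
  move=> /(_ us) H; have := H _ _ (a + u); rewrite addrK as_.
  move=> fa0; apply: val_inj; rewrite /= fP // fa0; last exact: map_f.
  + by rewrite /divxT tofrac0 mul0r.
  + move=> b; case: ifP => bs; last exact: homogeneous0.
    have := @homogeneous_xT _ _ (r - (p (b - u)).2) (pP (b - u)).1.
    by rewrite -addrA -mulrnDr subnKC ?rP // subrK.
  + apply/eqP; rewrite big_map -(divxT_eq0 _ r); apply/eqP.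
    transitivity (loc_val (\sum_(b <- s) c b)); last by rewrite sc0.
    rewrite loc_val_sum -divxT_sum; apply: eq_big_seq => b bs.
    by rewrite addrK bs fP.
Qed.

Definition locGr : grMod k n := GrMod loc_grading.

End Localization.

Section KerIm.
Variables (k : fieldType) (n : nat) (A B : grMod k n) (f : grHom A B).

Definition ker_pred : {pred A} := [pred x | f x == 0].
Definition im_pred : {pred B} := fun y => `[< exists x, y = f x >].

Lemma ker_closed : submod_closed ker_pred.
Proof.
split; first by rewrite inE linear0.
by move=> a x y; rewrite !inE linearP => /eqP -> /eqP ->; rewrite scaler0 addr0.
Qed.

Lemma ker_homog x : x \in ker_pred ->
  homog_sum (gdeg A) (fun y => y \in ker_pred) x.
Proof.
rewrite inE => /eqP fx0; have [s [c [us cP xE]]] := grading_sum (gdegP A) x.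
exists s, (fun a => if a \in s then c a else 0); split=> //; last first.
  by rewrite xE; apply: eq_big_seq => a ->.
move=> a; split; first case: ifP => _.
- exact: (cP a).1.
- exact: grading0 (gdegP A) a.
rewrite inE; case: ifP => as_; last by rewrite linear0.
apply/eqP; apply: (grading_uniq (gdegP B) (c := f \o c) us) as_ => [b|].
  by apply: ghom_deg; apply: (cP b).1.
by rewrite -raddf_sum -xE.
Qed.

Definition kerGr : grSub A := GrSub ker_closed ker_homog.

Lemma im_closed : submod_closed im_pred.
Proof.
split; first by apply/asboolP; exists 0; rewrite linear0.
move=> a _ _ /asboolP [x ->] /asboolP [y ->]; apply/asboolP.
by exists (a *: x + y); rewrite linearP.
Qed.

Lemma im_homog y : y \in im_pred ->
  homog_sum (gdeg B) (fun y => y \in im_pred) y.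
Proof.
move=> /asboolP [x ->]; have [s [c [us cP xE]]] := grading_sum (gdegP A) x.
exists s, (f \o c); split=> //; last by rewrite xE raddf_sum.
move=> a; split; first by apply: ghom_deg; apply: (cP a).1.
by apply/asboolP; exists (c a).
Qed.

Definition imGr : grSub B := GrSub im_closed im_homog.

End KerIm.

(* Local cohomology of R is defined by the Cech complex on the x_i, i in S, which
   also gives its Z^n-grading. *)

Section LocIncl.
Variables (k : fieldType) (n : nat).

(* The inclusion of R_(x_U) into R_(x_T) when U is included in T (and 0
   otherwise). *)
Definition loc_incl (U T : {set 'I_n}) (v : locGr k U) : locGr k T :=
  if U \subset T then insubd 0 (loc_val v) else 0.

Lemma divxT_sub (U T : {set 'I_n}) f t : U \subset T ->
  divxT U f t = divxT T (f * xT k (T :\: U) ^+ t) t.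
Proof.
move=> sUT; rewrite /divxT.
have -> : xT k T = xT k U * xT k (T :\: U).
  by rewrite /xT (big_setID U) /= (setIidPr sUT).
by rewrite exprMn !tofracM -mulf_div divff ?mulr1 ?xT_neq0.
Qed.

Lemma loc_inclE (U T : {set 'I_n}) (v : locGr k U) : U \subset T -> loc_val (loc_incl T v) = loc_val v.
Proof.
move=> sUT; rewrite /loc_incl sUT; apply: insubdK; have /asboolP [f [t ->]] := valP v.
by apply/asboolP; exists (f * xT k (T :\: U) ^+ t), t; rewrite (divxT_sub _ _ sUT).
Qed.

Lemma loc_incl_linear U T : linear (@loc_incl U T).
Proof.
move=> a v w; case sUT: (U \subset T); last first.
  by rewrite /loc_incl sUT scaler0 addr0.
apply: val_inj; rewrite [LHS]loc_inclE // [RHS]/=.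
rewrite [RHS](linearP (val : loc_type k T -> fracR k n)) /= !loc_inclE //.
Qed.

HB.instance Definition _ U T :=
  GRing.isLinear.Build _ _ _ _ (@loc_incl U T) (@loc_incl_linear U T).

Lemma loc_incl_deg (U T : {set 'I_n}) a (v : locGr k U) : gdeg (locGr k U) a v ->
  gdeg (locGr k T) a (loc_incl T v).
Proof.
case sUT: (U \subset T); last first.
  by move=> _; rewrite /loc_incl sUT; apply: (grading0 (gdegP (locGr k T))).
move=> [f [t [hf vE]]]; exists (f * xT k (T :\: U) ^+ t), t; split; last first.
  by rewrite loc_inclE // vE (divxT_sub _ _ sUT).
have -> : mdegZ (monT T) = mdegZ (monT U) + mdegZ (monT (T :\: U)) :> Zn n.
  by rewrite -mdegZD /monT (big_setID U) /= (setIidPr sUT).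
by rewrite mulrnDl addrA; apply: homogeneous_xT.
Qed.

End LocIncl.

Section Cech.
Variables (k : fieldType) (n : nat) (S : {set 'I_n}).

Definition cech_idx (p : nat) := {T : {set 'I_n} | (T \subset S) && (#|T| == p)}.

(* C^p = direct sum of the R_(x_T), for T included in S with p elements. *)
Definition cech (p : nat) : grMod k n :=
  dsumGr (fun T : cech_idx p => locGr k (val T)).

Definition cech_sign (T : {set 'I_n}) (i : 'I_n) : {mpoly k[n]} :=
  (-1) ^+ #|[set t in T | (t < i)%N]|.

(* (d c)_T = \sum_(i in T) +/- c_(T :\ i); the inner sum has exactly one term. *)
Definition cech_fun (p : nat) (c : cech p) : cech p.+1 := fun T =>
  \sum_(i in val T) \sum_(U : cech_idx p | val U == val T :\ i)
    cech_sign (val T) i *: loc_incl (val T) (c U).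

Lemma cech_linear p : linear (@cech_fun p).
Proof.
move=> a c c'; apply: functional_extensionality_dep => T.
transitivity (a *: cech_fun c T + cech_fun c' T) => //; rewrite /cech_fun.
rewrite scaler_sumr -big_split; apply: eq_bigr => i _ /=.
rewrite scaler_sumr -big_split; apply: eq_bigr => U _ /=.
by rewrite [X in loc_incl _ X]/(a *: c U + c' U) linearP scalerDr !scalerA mulrC.
Qed.

HB.instance Definition _ p :=
  GRing.isLinear.Build _ _ _ _ (@cech_fun p) (@cech_linear p).

Lemma cech_deg p a c : gdeg (cech p) a c -> gdeg (cech p.+1) a (cech_fun c).
Proof.
move=> hc T; have [h0 hB hZ _ _] := gdegP (locGr k (val T)).
have hD x y : gdeg (locGr k (val T)) a x -> gdeg (locGr k (val T)) a y ->
    gdeg (locGr k (val T)) a (x + y).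
  by move=> hx hy; rewrite -[y]opprK; apply: (hB) => //; rewrite -sub0r; apply: (hB).
apply: big_ind => // i _; apply: big_ind => // U _.
rewrite -[a]addr0; apply: hZ; last by apply: loc_incl_deg; apply: hc.
rewrite /cech_sign -signr_odd; case: (odd _); rewrite ?expr1 ?expr0.
  rewrite -sub0r; apply: homogeneousB; first exact: homogeneous0.
  by move=> m; rewrite msupp1 inE => /eqP ->; apply: mdegZ0.
by move=> m; rewrite msupp1 inE => /eqP ->; apply: mdegZ0.
Qed.

Definition cech_d (p : nat) : grHom (cech p) (cech p.+1) :=
  @GrHom k n (cech p) (cech p.+1) (@cech_fun p) (@cech_deg p).

(* H^p_I(R) for the ideal I = (x_i | i in S). *)
Definition local_cohomology (p : nat) : grMod k n :=
  match p with
  | 0 => subGr (kerGr (cech_d 0))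
  | q.+1 => subquot (imGr (cech_d q)) (kerGr (cech_d q.+1))
  end.

End Cech.

Section Straight.
Variables (k : fieldType) (n : nat).
Implicit Types (M : grMod k n) (a : Zn n).

Definition supp_pos a : {set 'I_n} := [set i | 0 < a i].

(* d = dim_k M_a *)
Definition has_dim M a (d : nat) : Prop :=
  exists b : 'I_d -> M, (forall i, gdeg M a (b i)) /\
    forall y, gdeg M a y ->
      exists! c : {ffun 'I_d -> k}, y = \sum_i (c i)%:MP *: b i.

Definition straight M : Prop :=
  (forall a, exists d, has_dim M a d) /\
  (forall a (b : 'X_{1..n}), supp_pos (a + mdegZ b) = supp_pos a ->
     forall z, gdeg M (a + mdegZ b) z ->
       exists! y, gdeg M a y /\ 'X_[b] *: y = z).

Definition epsZ : Zn n := [ffun=> -1].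

Definition eps_straight M : Prop := straight (grShift M epsZ).

(* Omega = {-1, 0}^n is parametrized by the subsets S of {1, ..., n}: S is the
   set of the i with a_i = -1, so that |a| = #|S| and p_a = (x_i | i in S). *)
Definition omega (S : {set 'I_n}) : Zn n := [ffun i => if i \in S then -1 else 0].

End Straight.

Section Extensions.
Variables (k : fieldType) (n : nat).

(* 0 -> A -> E -> B -> 0, with the arguments in the order of Ext^1(B, A). *)
Record extension (B A : grMod k n) := Extension {
  ext_mid :> grMod k n;
  ext_inj : grHom A ext_mid;
  ext_proj : grHom ext_mid B;
  ext_injP : injective ext_inj;
  ext_projP : forall y, exists x, ext_proj x = y;
  ext_exact : forall x, ext_proj x = 0 <-> exists z, x = ext_inj z
}.

Definition ext_equiv (B A : grMod k n) (E E' : extension B A) : Prop :=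
  exists f : grHom E E',
    [/\ bijective f, forall z, f (ext_inj E z) = ext_inj E' z
      & forall x, ext_proj E' (f x) = ext_proj E x].

(* The class of E in the Yoneda group Ext^1(B, A) of the category of graded
   modules. *)
Definition ext_class (B A : grMod k n) (E : extension B A) :
  extension B A -> Prop := ext_equiv E.

End Extensions.

Section SubExtension.
Variables (k : fieldType) (n : nat) (M : grMod k n) (N' N : grSub M).
Hypothesis sN'N : {subset N' <= N}.

Definition sub_incl (x : subGr N') : subGr N := SubElt (sN'N (valP x)).

Lemma sub_incl_linear : linear sub_incl.
Proof. move=> a x y; apply: val_inj => /=.
by rewrite [LHS](linearP (val : sub_type N' -> M)). Qed.

HB.instance Definition _ :=
  GRing.isLinear.Build _ _ _ _ sub_incl sub_incl_linear.

Lemma sub_incl_deg a x : gdeg (subGr N') a x -> gdeg (subGr N) a (sub_incl x).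
Proof. by []. Qed.

Definition sub_hom : grHom (subGr N') (subGr N) :=
  @GrHom k n (subGr N') (subGr N) sub_incl sub_incl_deg.

Lemma sub_hom_inj : injective sub_hom.
Proof. by move=> x y /(congr1 val) /= e; apply: val_inj. Qed.

Lemma subquot_surj y : exists x, subquot_pi N' N x = y.
Proof. by exists (repr y); apply: quot_repr. Qed.

Lemma subquot_exact x :
  subquot_pi N' N x = 0 <-> exists z, x = sub_hom z.
Proof.
rewrite -[0](linear0 (subquot_pi N' N)); split.
- move=> /quot_piP; rewrite subr0 inE => xN'; exists (SubElt (xN' : gsmem N' _)).
  exact: val_inj.
- by move=> [z ->]; apply/quot_piP; rewrite subr0 inE; apply: (valP z).
Qed.

Definition sub_extension : extension (subquot N' N) (subGr N') :=
  Extension sub_hom_inj subquot_surj subquot_exact.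

(* The identifications, for an extension 0 -> N' -> E -> N / N' -> 0, of
   elements of E and of M: e and y are identified if y is in N and has the same
   image in N / N' as e, resp. if both are the image of an element of N'. *)
Definition ident_quot (E : extension (subquot N' N) (subGr N')) (e : E) (y : M) :
  Prop := exists2 x : subGr N, sub_val x = y & subquot_pi N' N x = ext_proj E e.

Definition ident_sub (E : extension (subquot N' N) (subGr N')) (e : E) (y : M) :
  Prop := exists2 z : subGr N', sub_val z = y & ext_inj E z = e.

End SubExtension.

(* Main.v *)
(* Put A = F_(j-1), B = F_j / F_(j-1), and let neg a be the set of the i with
   a_i < 0.  A straight module is determined in degree a by its component in
   degree omega (neg a).  Computing H^j_(p_S)(R) in the degrees of Omega gives
   B_a = 0 unless #|neg a| = j; comparing dimensions gives A_a = 0 if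
   #|neg a| = j.  So for an extension X of B by A, X_a is B_a if #|neg a| = j and
   A_a otherwise, and two extensions are identified degree by degree.  This is
   compatible with multiplication by x_i except perhaps when a_i = -1 and
   #|neg a| = j, where straightness reduces it to the degrees of Omega. *)

Require Import Defs.
From HB Require Import structures.
From mathcomp Require Import all_boot all_order all_algebra.
From mathcomp Require Import boolp.
From mathcomp Require Import mpoly.
From mathcomp Require Import zify.

Set Implicit Arguments.
Unset Strict Implicit.
Unset Printing Implicit Defensive.

Import GRing.Theory.
Local Open Scope ring_scope.

(** * Sums of homogeneous elements, grouped by degree *)

Lemma sum_fibers (I : Type) (T : eqType) (V : nmodType) (d : I -> T)
    (c : I -> V) (s : seq I) (t : seq T) :
  uniq t -> all (fun i => d i \in t) s ->
  \sum_(i <- s) c i = \sum_(a <- t) \sum_(i <- s | d i == a) c i.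
Proof.
move=> ut; elim: s => [_|i s IHs /= /andP[it st]].
  by rewrite big_nil big1 // => a _; rewrite big_nil.
under [RHS]eq_bigr => a _ do rewrite big_cons.
rewrite big_cons (IHs st) (bigD1_seq _ it ut) [RHS](bigD1_seq _ it ut) /= eqxx addrA.
by congr (_ + _); apply: eq_bigr => a /negPf; rewrite eq_sym => ->.
Qed.

Lemma gdegD (k : fieldType) (n : nat) (M : grMod k n) (a : Zn n) (x y : M) :
  gdeg M a x -> gdeg M a y -> gdeg M a (x + y).
Proof.
have [h0 hB _ _ _] := gdegP M; move=> xa ya.
by rewrite -[y]opprK; apply: (hB) => //; rewrite -sub0r; apply: (hB).
Qed.

Lemma gdegX (k : fieldType) (n : nat) (M : grMod k n) (a : Zn n) (m : 'X_{1..n})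
    (x : M) :
  gdeg M a x -> gdeg M (a + mdegZ m) ('X_[m] *: x).
Proof. by apply: (gradingZ (gdegP M)); apply: homogeneousX. Qed.

Lemma gdegC (k : fieldType) (n : nat) (M : grMod k n) (a : Zn n) (c : k) (x : M) :
  gdeg M a x -> gdeg M a (c%:MP *: x).
Proof.
move=> xa; rewrite -[a]addr0; apply: (gradingZ (gdegP M)) xa => m.
by rewrite msuppC; case: ifP => // _; rewrite inE => /eqP ->; apply: mdegZ0.
Qed.

(** [grading_uniq] requires pairwise distinct degrees; here degrees may repeat, so the terms are
    first collected by degree. *)
Lemma sum_fiber_eq0 (k : fieldType) (n : nat) (M : grMod k n) (I : Type)
    (s : seq I) (d : I -> Zn n) (c : I -> M) :
  (forall i, gdeg M (d i) (c i)) -> \sum_(i <- s) c i = 0 ->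
  forall a, \sum_(i <- s | d i == a) c i = 0.
Proof.
(* The degree [a] is added to the list to cover the case where no term has it. *)
move=> dc s0 a; pose t := undup (a :: map d s).
apply: (grading_uniq (gdegP M) (s := t) (c := fun a => \sum_(i <- s | d i == a) c i)).
- exact: undup_uniq.
- move=> b; apply: big_ind => [|x y|i /eqP <- //]; last exact: gdegD.
  exact: grading0 (gdegP M) b.
- rewrite -[RHS]s0 (sum_fibers (d := d) c (undup_uniq (a :: map d s))) //.
  have : all (mem t) (map d s) by apply/allP => b bs; rewrite /= mem_undup inE bs orbT.
  by rewrite all_map.
- by rewrite mem_undup inE eqxx.
Qed.

(** * Graded morphisms given by a relation in each degree *)

Section GradedRelation.
Variables (k : fieldType) (n : nat) (X Y : grMod k n).
Variable Rel : Zn n -> X -> Y -> Prop.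
Hypothesis Rel_deg : forall a x y, Rel a x y -> gdeg X a x /\ gdeg Y a y.
Hypothesis Rel0 : forall a, Rel a 0 0.
Hypothesis RelD : forall a x y x' y',
  Rel a x y -> Rel a x' y' -> Rel a (x + x') (y + y').
Hypothesis RelX : forall a c m x y,
  Rel a x y -> Rel (a + mdegZ m) ((c *: 'X_[m]) *: x) ((c *: 'X_[m]) *: y).
Hypothesis Rel_total : forall a x, gdeg X a x -> exists y, Rel a x y.
Hypothesis Rel_fun : forall a y, Rel a 0 y -> y = 0.

(** Each pair keeps its degree, so that a sum in the span can later be split by degree. *)
Let pairs := {p : Zn n * (X * Y) | Rel p.1 p.2.1 p.2.2}.
Let pair a x y (h : Rel a x y) : pairs := exist _ (a, (x, y)) h.

Let rel_span (x : X) (y : Y) := exists s : seq pairs,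
  x = \sum_(p <- s) (sval p).2.1 /\ y = \sum_(p <- s) (sval p).2.2.

Let span_D x y x' y' :
  rel_span x y -> rel_span x' y' -> rel_span (x + x') (y + y').
Proof.
by move=> [s [-> ->]] [s' [-> ->]]; exists (s ++ s'); rewrite !big_cat.
Qed.

Let span_1 a x y : Rel a x y -> rel_span x y.
Proof. by move=> h; exists [:: pair h]; rewrite !big_seq1. Qed.

Let span_0 : rel_span 0 0. Proof. by exists [::]; rewrite !big_nil. Qed.

Let span_Z f x y : rel_span x y -> rel_span (f *: x) (f *: y).
Proof.
move=> [s [-> ->]]; rewrite [f]mpolyE !scaler_suml.
elim/big_rec2: _ => // m x' y' _; apply: span_D; rewrite !scaler_sumr.
elim: s => [|[[a [u v]] /= h] s IHs]; first by rewrite !big_nil.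
rewrite !big_cons; apply: span_D IHs; exact: span_1 (RelX _ _ h).
Qed.

Let span_fun y : rel_span 0 y -> y = 0.
Proof.
move=> [s [s0 ->]]; pose d (p : pairs) := (sval p).1.
rewrite (@sum_fibers _ _ _ d _ _ (undup (map d s))) ?undup_uniq //; last first.
  have : all (mem (undup (map d s))) (map d s).
    by apply/allP => a as_; rewrite /= mem_undup.
  by rewrite all_map.
(* In each degree the first components add up to 0, and by [RelD] the two partial sums are still
   related, so [Rel_fun] applies. *)
apply: big1 => a _; apply: (Rel_fun (a := a)).
have := @sum_fiber_eq0 k n X _ s d (fun p => (sval p).2.1) _ (esym s0) a.
move=> <-; last first.
  by move=> p; have [] := Rel_deg (svalP p).
apply: (big_ind2 (fun u v => Rel a u v)) => [|u v u1 v1|p /eqP <-] //.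
  exact: RelD.
exact: (svalP p).
Qed.

(** The span of [Rel] is stable under sums and scalars, and by [span_fun] it relates 0 only to 0;
    hence it is the graph of a linear map. *)
Lemma graded_relation_hom : exists f : grHom X Y, forall a x y, Rel a x y -> f x = y.
Proof.
have span_inj x y y' : rel_span x y -> rel_span x y' -> y = y'.
  move=> h /(span_Z (-1)) h'; apply/eqP; rewrite -subr_eq0 -scaleN1r; apply/eqP/span_fun.
  by rewrite -(subrr x) -scaleN1r; apply: span_D.
have /choice [f fP] x : exists y, rel_span x y.
  have [s [c [_ cP ->]]] := grading_sum (gdegP X) x.
  have /choice [g gP] a := Rel_total (cP a).1.
  by exists (\sum_(a <- s) g a); elim/big_rec2: _ => // a u v _; apply/span_D/span_1/gP.
have f_linear : linear f.
  by move=> c x y; apply: span_inj (fP _) _; apply: span_D (fP _); apply: span_Z.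
pose fL := GRing.isLinear.Build _ _ _ _ f f_linear.
pose F : {linear X -> Y} := HB.pack f fL.
have F_Rel a x y : Rel a x y -> F x = y.
  by move=> /span_1; apply: span_inj; apply: fP.
have F_deg a x : gdeg X a x -> gdeg Y a (F x).
  by move=> /Rel_total [y h]; rewrite (F_Rel _ _ _ h); have [] := Rel_deg h.
by exists (GrHom F_deg).
Qed.

End GradedRelation.

(** * Lifting of degrees, and equivalence of extensions *)

Lemma grHom_eq (k : fieldType) (n : nat) (X : grMod k n) (V : zmodType)
    (f g : {additive X -> V}) :
  (forall a x, gdeg X a x -> f x = g x) -> f =1 g.
Proof.
move=> fg x; have [s [c [_ cP ->]]] := grading_sum (gdegP X) x.
by rewrite !raddf_sum; apply: eq_bigr => a _; apply: fg (cP a).1.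
Qed.

(** The part of degree [a] of [x] has the same image as [x], because [f] preserves degrees and [f x]
    has only a component of degree [a]. *)
Lemma grHom_lift_deg (k : fieldType) (n : nat) (X Y : grMod k n) (f : grHom X Y) a x :
  gdeg Y a (f x) -> exists2 x', gdeg X a x' & f x' = f x.
Proof.
move=> fxa; have [s [c [_ cP xE]]] := grading_sum (gdegP X) x.
exists (\sum_(b <- s | b == a) c b).
  apply: big_ind => [|u v|b /eqP <-]; last exact: (cP b).1.
    exact: grading0 (gdegP X) a.
  exact: gdegD.
(* The index [None] carries [- f x] in degree [a]: the whole family sums to 0, hence so does its
   part of degree [a]. *)
have := @sum_fiber_eq0 k n Y _ (None :: map some s) (odflt a)
  (fun o => if o is Some b then f (c b) else - f x).
rewrite big_cons big_map /= -raddf_sum -xE addNr => /(_ _ erefl a).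
rewrite big_cons big_map /= eqxx raddf_sum => fiber0.
apply/eqP; rewrite -subr_eq0 addrC fiber0 // => -[b|] /=.
  by apply: ghom_deg; apply: (cP b).1.
by rewrite -sub0r; apply: (gradingB (gdegP Y)) => //; apply: (grading0 (gdegP Y)).
Qed.

Lemma grHom_inj_deg (k : fieldType) (n : nat) (X Y : grMod k n) (f : grHom X Y) a x :
  injective f -> gdeg Y a (f x) -> gdeg X a x.
Proof. by move=> f_inj /grHom_lift_deg [x' + /f_inj <-]. Qed.

(** The short five lemma: such an [f] is automatically bijective. *)
Lemma ext_equiv_hom (k : fieldType) (n : nat) (B A : grMod k n)
    (E E' : extension B A) (f : grHom E E') :
  (forall z, f (ext_inj E z) = ext_inj E' z) ->
  (forall x, ext_proj E' (f x) = ext_proj E x) -> ext_equiv E E'.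
Proof.
move=> f_inj f_proj; exists f; split=> //.
have f_injective : injective f.
  apply: raddf_inj => x fx0.
  have /ext_exact [a xE] : ext_proj E x = 0 by rewrite -f_proj fx0 raddf0.
  move: fx0; rewrite xE => /(etrans (esym (f_inj a))) a0.
  by rewrite (ext_injP (etrans a0 (esym (raddf0 (ext_inj E'))))) raddf0.
have /choice [g gP] y : exists x, f x = y.
  have [x xE] := ext_projP E (ext_proj E' y).
  have /ext_exact [a aE] : ext_proj E' (y - f x) = 0 by rewrite raddfB /= f_proj xE subrr.
  by exists (x + ext_inj E a); rewrite raddfD /= f_inj -aE addrC subrK.
by exists g => // x; apply: f_injective; rewrite gP.
Qed.

Lemma ext_equiv_trans (k : fieldType) (n : nat) (B A : grMod k n)
    (E1 E2 E3 : extension B A) :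
  ext_equiv E1 E2 -> ext_equiv E2 E3 -> ext_equiv E1 E3.
Proof.
move=> [f [_ fi fp]] [g [_ gi gp]].
have gf_deg a x : gdeg E1 a x -> gdeg E3 a ((g \o f) x).
  by move=> xa; do 2!apply: ghom_deg.
by apply: (ext_equiv_hom (f := GrHom gf_deg)) => x /=; rewrite ?fi ?gp.
Qed.

(** With both directions given, transitivity is enough and no inverse morphism has to be built. *)
Lemma ext_class_eq (k : fieldType) (n : nat) (B A : grMod k n)
    (E E' : extension B A) :
  ext_equiv E E' -> ext_equiv E' E -> ext_class E = ext_class E'.
Proof.
move=> h h'; apply: funext => X; apply: propext.
by split; apply: ext_equiv_trans.
Qed.

(** * Negative supports of degrees, and straightness *)

Definition neg_supp (n : nat) (a : Zn n) : {set 'I_n} := [set i | a i < 0].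

Lemma neg_supp_omega (n : nat) (S : {set 'I_n}) : neg_supp (omega S) = S.
Proof. by apply/setP => i; rewrite inE ffunE; case: (i \in S). Qed.

(** In general [a] and [omega (neg_supp a)] are not comparable, so they are linked through
    [b = min(a, 0)]: the positive entries of [a] give [m], and [m'] raises each negative entry to
    -1. *)
Lemma common_lower_degree (n : nat) (a : Zn n) :
  exists (b : Zn n) (m m' : 'X_{1..n}),
    [/\ b + mdegZ m = a, b + mdegZ m' = omega (neg_supp a),
        neg_supp b = neg_supp a & forall i, a i = -1 -> b i = -1].
Proof.
exists [ffun i => if i \in neg_supp a then a i else 0],
  [multinom (if i \in neg_supp a then 0%N else absz (a i)) | i < n],
  [multinom (if i \in neg_supp a then absz (a i + 1)%R else 0%N) | i < n].
split.
- apply/ffunP => i; rewrite !ffunE mnmE inE.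
  by move: (a i) => x; case: ifP => x0; lia.
- apply/ffunP => i; rewrite !ffunE mnmE inE.
  by move: (a i) => x; case: ifP => x0; lia.
- by apply/setP => i; rewrite !inE ffunE inE; case: ifP.
- by move=> i ai; rewrite ffunE inE ai.
Qed.

Section MulBij.
Variables (k : fieldType) (n : nat).
Implicit Types (M : grMod k n) (a : Zn n) (m : 'X_{1..n}).

(* [eps_straight] without the finiteness condition, and without the shift: under
   [a |-> epsZ + a], the complement of [supp_pos] becomes [neg_supp]. *)
Definition mul_bij M : Prop :=
  forall a m, neg_supp (a + mdegZ m) = neg_supp a ->
    (forall y, gdeg M a y -> 'X_[m] *: y = 0 -> y = 0) /\
    (forall z, gdeg M (a + mdegZ m) z -> exists2 y, gdeg M a y & 'X_[m] *: y = z).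

Lemma eps_straight_mul_bij M : eps_straight M -> mul_bij M.
Proof.
move=> [_ h] a m am.
have supp_shift (b : Zn n) : supp_pos (b - epsZ n) = ~: neg_supp b.
  by apply/setP => i; rewrite !inE !ffunE; move: (b i) => x; lia.
have degE b : epsZ n + (b - epsZ n) = b by rewrite addrC subrK.
have {h} := h (a - epsZ n) m; rewrite addrAC !supp_shift am => /(_ erefl).
rewrite /= /shift_deg !degE => h; split.
- move=> y ya y0; have [z [_ zu]] := h 0 (grading0 (gdegP M) _).
  rewrite -(zu y) // (zu 0) //; split; last by rewrite scaler0.
  exact: (grading0 (gdegP M)).
- by move=> z /h [y [[ya yz] _]]; exists y.
Qed.

(** Divide by ['X_[m]] down to the common lower degree, then multiply by ['X_[m']] up to [omega S];
    the negative support never changes, so both maps are bijective. *)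
Lemma mul_bij_eq0 M S :
  mul_bij M -> (forall y, gdeg M (omega S) y -> y = 0) ->
  forall a y, neg_supp a = S -> gdeg M a y -> y = 0.
Proof.
move=> M_bij M0 a y aS; have [b [m [m' [ma m'S bS _]]]] := common_lower_degree a.
rewrite -ma => ya.
have [_ surj] := M_bij b m (etrans (congr1 _ ma) (esym bS)).
have [z zb <-] := surj y ya; rewrite aS in m'S bS.
have [inj _] := M_bij b m' (etrans (congr1 _ m'S) (etrans (neg_supp_omega S) (esym bS))).
by rewrite (inj z) ?scaler0 //; apply: M0; rewrite -m'S; apply: gdegX.
Qed.

(** Surjectivity passes to the quotient. For injectivity, if ['X_[m] *: y] lies in [N'], it is
    ['X_[m] *: z] with [z] in [N'], and [z = y] by injectivity on [N]. *)
Lemma subquot_mul_bij M (N' N : grSub M) :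
  {subset N' <= N} -> mul_bij (subGr N') -> mul_bij (subGr N) ->
  mul_bij (subquot N' N).
Proof.
move=> sN bij' bij a m am; have [inj' surj'] := bij' a m am; have [inj surj] := bij a m am.
split=> [_ [y ya ->]|_ [z za ->]].
- rewrite -linearZ -[RHS](raddf0 (quot_pi (relsub N' N))) => /quot_piP.
  rewrite subr0 inE => yN'.
  have [z za zE] := surj' (SubElt (yN' : gsmem N' _)) (gdegX m ya).
  suff <- : sub_incl sN z = y.
    rewrite -[RHS](raddf0 (quot_pi (relsub N' N))); apply/quot_piP.
    by rewrite subr0 inE; apply: (valP z).
  apply/eqP; rewrite -subr_eq0; apply/eqP/inj.
    exact: (gradingB (gdegP (subGr N))).
  apply: val_inj; rewrite scalerBr /= -[RHS](subrr (val ('X_[m] *: y))).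
  by congr (_ - _); exact: (congr1 val zE).
- have [y ya <-] := surj z za; exists (quot_pi (relsub N' N) y); first by exists y.
  by rewrite linearZ.
Qed.

End MulBij.

(** * Top local cohomology of [R] in the degrees of Omega *)

Lemma homogeneous_monomial (k : fieldType) (n : nat) (a : Zn n) (f : {mpoly k[n]}) :
  homogeneous a f -> f != 0 ->
  exists (m : 'X_{1..n}) (c : k), mdegZ m = a /\ f = c *: 'X_[m].
Proof.
move=> hf; rewrite -msupp_eq0; case E: (msupp f) => [//|m s] _.
have mf : m \in msupp f by rewrite E inE eqxx.
exists m, f@_m; split; first exact: hf.
apply/mpolyP => m'; rewrite mcoeffZ mcoeffX.
have [<-|mm'] := eqVneq m m'; first by rewrite mulr1.
rewrite mulr0; apply: memN_msupp_eq0; apply: contra mm' => /hf m'a.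
by apply/eqP/(@mdegZ_inj n); rewrite m'a hf.
Qed.

Lemma monTE (n : nat) (S : {set 'I_n}) i : monT S i = (i \in S).
Proof.
rewrite /monT mnm_sumE; under eq_bigr => j _ do rewrite mnm1E.
have [iS|iS] := boolP (i \in S).
  by rewrite (bigD1 i) //= eqxx big1 ?addn0 // => j /andP[_ /negPf ->].
by rewrite big1 // => j jS; apply/eqP; rewrite eqb0; apply: contra iS => /eqP <-.
Qed.

(** At an index of [T] outside [S] the exponent would be -1, but that variable is not inverted. *)
Lemma loc_omega_eq0 (k : fieldType) (n : nat) (S T : {set 'I_n}) (v : locGr k S) :
  ~~ (T \subset S) -> gdeg (locGr k S) (omega T) v -> v = 0.
Proof.
move=> /subsetPn [i iT iS] [f [t [hf vE]]]; apply: val_inj; rewrite /= vE.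
have [->|f0] := eqVneq f 0; first by rewrite /divxT tofrac0 mul0r.
have [m [c [/ffunP /(_ i) + _]]] := homogeneous_monomial hf f0.
by rewrite !ffunE -mulrz_nat ffunMzE; rewrite ffunE monTE iT (negPf iS) mul0rz addr0.
Qed.

Section TopLocalCohomology.
Variables (k : fieldType) (n : nat) (S : {set 'I_n}).

Lemma cech_idx_top p (U : cech_idx S p) : #|S| = p -> val U = S.
Proof.
by move=> Sp; have /andP[US /eqP Up] := valP U; apply/eqP; rewrite eqEcard US Sp Up /=.
Qed.

(** The exponent at [i] is 0, so the numerator contains exactly [x_i^t], which cancels [x_i] from
    the denominator. *)
Lemma loc_omega_incl (T : {set 'I_n}) i (v : locGr k S) :
  i \in S -> i \notin T -> gdeg (locGr k S) (omega T) v ->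
  exists w : locGr k (S :\ i), loc_incl S w = v.
Proof.
move=> iS iT [f [t [hf vE]]].
have [f0|f0] := eqVneq f 0.
  by exists 0; rewrite linear0; apply: val_inj; rewrite /= vE f0 /divxT tofrac0 mul0r.
have [m [c [/ffunP /(_ i) + fE]]] := homogeneous_monomial hf f0.
rewrite !ffunE -mulrz_nat ffunMzE ffunE monTE iS (negPf iT) add0r => mi.
have {}mi : m i = t by lia.
exists (LocElt (loc_divxT (S :\ i) (c *: 'X_[m - U_(i) *+ t]) t)).
apply: val_inj; rewrite [LHS]loc_inclE ?subsetDl //= vE (@divxT_sub k n (S :\ i) S) ?subsetDl //.
have -> : S :\: (S :\ i) = [set i] by rewrite setDDr setDv set0U; apply/setIidPr; rewrite sub1set.
rewrite fE /xT big_set1 -scalerAl mpolyXn -mpolyXD; congr (divxT _ (_ *: 'X_[_]) _).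
apply/mnmP => l; rewrite mnmDE mnmBE mulmnE mnm1E.
by have [<-|_] := eqVneq i l; lia.
Qed.

(** The preimage is concentrated on [S :\ i], and the sign put into it cancels the sign of the
    differential. *)
Lemma cech_d_single p (i : 'I_n) (w : locGr k (S :\ i)) (v : cech k S p.+1) :
  #|S| = p.+1 -> i \in S -> (forall U, loc_val (v U) = loc_val w) ->
  exists c, v = cech_d k S p c.
Proof.
move=> Sp iS vw.
pose c : cech k S p := fun U =>
  if val U == S :\ i then cech_sign k S i *: loc_incl (val U) w else 0.
have Sip : (S :\ i \subset S) && (#|S :\ i| == p).
  by rewrite subsetDl cardsDS ?sub1set // cards1 Sp subn1 /=.
exists c; apply: functional_extensionality_dep => T; rewrite /= /cech_fun.
have TS := cech_idx_top T Sp.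
rewrite (bigD1 i) ?TS //= [X in _ + X]big1 ?addr0; last first.
  move=> i' /andP[i'S i'i]; apply: big1 => U /eqP US; rewrite /= TS in i'S US.
  have /negPf c0 : val U != S :\ i.
    rewrite /= US.
    by apply: contra i'i => /eqP /setP /(_ i'); rewrite !inE i'S eqxx !andbT /= => /esym/negbFE.
  by rewrite /c c0 linear0 scaler0.
rewrite (big_pred1 (Sub (S :\ i) Sip : cech_idx S p)); last by move=> U; rewrite /= TS.
have -> : c (Sub (S :\ i) Sip) = cech_sign k S i *: loc_incl (S :\ i) w by rewrite /c /= eqxx.
have -> : cech_sign k (sval T) i = cech_sign k S i by rewrite [sval T]TS.
have ss : cech_sign k S i * cech_sign k S i = 1 by rewrite -exprMn mulrNN mulr1 expr1n.
rewrite linearZ scalerA ss scale1r; apply: val_inj.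
have SiT : S :\ i \subset val T by rewrite TS subsetDl.
by rewrite [RHS]loc_inclE // loc_inclE ?subsetDl //; apply: vw.
Qed.

(** If [T] is not inside [S], the cocycle itself vanishes. Otherwise some [i] in [S] is outside [T],
    and the cocycle comes from the localization at [S :\ i], so it is a boundary. *)
Lemma local_cohomology_omega_eq0 (T : {set 'I_n}) p (u : local_cohomology k S p) :
  #|S| = p -> (0 < p)%N -> T != S -> gdeg (local_cohomology k S p) (omega T) u -> u = 0.
Proof.
case: p u => // p u Sp _ TS [[y yK] yT ->].
rewrite -[RHS](raddf0 (quot_pi (relsub (imGr (cech_d k S p)) (kerGr (cech_d k S p.+1))))).
apply/quot_piP; rewrite subr0 inE /=; apply/asboolP.
have [sTS|sTS] := boolP (T \subset S); last first.
  exists 0; rewrite linear0; apply: functional_extensionality_dep => U.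
  by apply: (loc_omega_eq0 (T := T)); [rewrite [val U](cech_idx_top U Sp) | exact: yT].
have /subsetPn [i iS iT] : ~~ (S \subset T) by apply: contra TS; rewrite eqEsubset sTS.
have SS : (S \subset S) && (#|S| == p.+1) by rewrite subxx Sp eqxx.
have [w /= wE] := loc_omega_incl iS iT (yT (Sub S SS)).
apply: (@cech_d_single p i w) => // U.
have -> : U = Sub S SS by apply: val_inj; rewrite [LHS](cech_idx_top U Sp).
by rewrite -wE loc_inclE ?subsetDl.
Qed.

(* The coefficient of [f / x_S^(t+1)] at [x_S^-1] is that of [f] at [x_S^t]. *)
Definition no_residue (v : fracR k n) : Prop :=
  exists (f : {mpoly k[n]}) (t : nat),
    v = divxT S f t.+1 /\ f@_(monT S *+ t)%MM = 0.

Lemma mcoeff_xT (f : {mpoly k[n]}) m s :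
  (f * xT k S ^+ s)@_(m + monT S *+ s)%MM = f@_m.
Proof. by rewrite xTE mpolyXn addmC mcoeffMX. Qed.

Lemma no_residue0 : no_residue 0.
Proof. by exists 0, 0%N; rewrite /divxT tofrac0 mul0r mcoeff0. Qed.

Lemma no_residueB v w : no_residue v -> no_residue w -> no_residue (v - w).
Proof.
move=> [f [t [-> f0]]] [g [s [-> g0]]].
exists (f * xT k S ^+ s.+1 - g * xT k S ^+ t.+1), (t + s.+1)%N; split.
  by rewrite divxTB -[(t + s.+1).+1]/(t.+1 + s.+1)%N -divxT_up [(t.+1 + _)%N]addnC -divxT_up.
have mulD a b : (monT S *+ (a + b) = monT S *+ a + monT S *+ b)%MM.
  by apply/mnmP => i; rewrite mnmDE !mulmnE mulnDr.
rewrite mcoeffB [in X in X - _]mulD mcoeff_xT f0.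
by rewrite addnS -addSn addnC mulD mcoeff_xT g0 subr0.
Qed.

(** For [i] in [S] outside [U] there is no pole along [x_i]: over the denominator [x_S^(t+1)], the
    numerator has exponent at least [t+1] at [i], beyond the [t] of the residue monomial. *)
Lemma no_residue_incl (U : {set 'I_n}) (v : locGr k U) :
  U \proper S -> no_residue (loc_val (loc_incl S v)).
Proof.
move=> /properP [US [i iS iU]]; rewrite loc_inclE //.
have /asboolP [f [t ->]] := valP v.
exists (f * xT k U * xT k (S :\: U) ^+ t.+1), t; split.
  by rewrite (divxT_up U f t 1) addn1 expr1 (divxT_sub _ _ US).
rewrite [xT k (S :\: U)]xTE mpolyXn mulrC; apply: memN_msupp_eq0.
apply/negP => /msuppM_le /allpairsP [[m1 m2] /= []].
rewrite msuppX inE => /eqP -> _ /mnmP /(_ i).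
by rewrite mulmnE mnmDE mulmnE !monTE inE iU iS mul1n; lia.
Qed.

Lemma residue_xT : ~ no_residue (divxT S 1 1).
Proof.
move=> [f [t [/eqP + f0]]]; rewrite (divxT_up S 1 1 t) add1n mul1r -subr_eq0 -divxTB divxT_eq0.
rewrite subr_eq0 => /eqP fE; move: f0; rewrite -fE xTE mpolyXn mcoeffX eqxx => /eqP.
by rewrite oner_eq0.
Qed.

(** The class of [1 / x_S] is nonzero: a boundary is a signed sum of elements coming from proper
    subsets of [S], hence has no residue. *)
Lemma local_cohomology_omega p : #|S| = p -> (0 < p)%N ->
  exists2 u, gdeg (local_cohomology k S p) (omega S) u & u <> 0.
Proof.
case: p => // p Sp _.
pose y : cech k S p.+1 := fun U => LocElt (loc_divxT (val U) 1 1).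
(* The next Cech module has no summand, since an index would be a subset of [S] with [p.+2]
   elements. *)
have yK : gsmem (kerGr (cech_d k S p.+1)) y.
  rewrite /gsmem inE; apply/eqP/functional_extensionality_dep => T.
  have /andP[/subset_leq_card + /eqP Tp] := valP T.
  by rewrite Sp Tp ltnn.
exists (quot_pi (relsub (imGr (cech_d k S p)) (kerGr (cech_d k S p.+1))) (SubElt yK)).
  exists (SubElt yK) => // U; exists 1, 1%N; split=> //= m.
  rewrite msupp1 inE => /eqP ->; rewrite mdegZ0 [sval U](cech_idx_top U Sp) mulr1n.
  by apply/ffunP => i; rewrite !ffunE monTE; case: (i \in S).
rewrite -[X in _ <> X](raddf0 (quot_pi (relsub (imGr (cech_d k S p)) (kerGr (cech_d k S p.+1))))).
move=> /quot_piP; rewrite subr0 inE /= => /asboolP [c /= yc].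
have SS : (S \subset S) && (#|S| == p.+1) by rewrite subxx Sp eqxx.
apply: residue_xT; have -> : divxT S 1 1 = loc_val (y (Sub S SS)) by [].
rewrite yc /= /cech_fun.
have no_residueD v w : no_residue v -> no_residue w -> no_residue (v + w).
  move=> hv hw; rewrite -[w]opprK; apply: no_residueB => //.
  by rewrite -sub0r; apply: no_residueB hw; apply: no_residue0.
apply: (big_ind (fun v : locGr k S => no_residue (loc_val v))) => [||i iS];
[exact: no_residue0 | by move=> v w; apply: no_residueD |].
apply: (big_ind (fun v : locGr k S => no_residue (loc_val v))) => [||U /eqP US];
[exact: no_residue0 | by move=> v w; apply: no_residueD |].
have h : no_residue (loc_val (loc_incl S (c U))).
  by apply: no_residue_incl; rewrite US /=; apply: properD1.
rewrite /cech_sign -signr_odd; case: (odd _); last by rewrite expr0 scale1r.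
rewrite expr1 scaleN1r -sub0r.
exact: no_residueB no_residue0 h.
Qed.

End TopLocalCohomology.

(** * Comparison of two extensions with the same maps in the degrees of Omega *)

Section StraightExtensions.
Variables (k : fieldType) (n : nat) (A B : grMod k n) (j : nat).
Hypothesis A_bij : mul_bij A.
Hypothesis B_bij : mul_bij B.
Hypothesis A_eq0 : forall S : {set 'I_n}, #|S| = j ->
  forall z, gdeg A (omega S) z -> z = 0.
Hypothesis B_eq0 : forall T : {set 'I_n}, #|T| <> j ->
  forall y, gdeg B (omega T) y -> y = 0.

Section TwoExtensions.
Variables E E' : extension B A.
(** This form is symmetric in [E] and [E'], so that each can be mapped to the other. *)
Hypothesis same_maps : forall S : {set 'I_n}, #|S| = j -> forall i, i \in S ->
  forall (e : E) (e' : E'), gdeg E (omega S) e -> gdeg E' (omega S) e' ->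
    ext_proj E e = ext_proj E' e' ->
    exists z, 'X_i *: e = ext_inj E z /\ 'X_i *: e' = ext_inj E' z.

Let A_deg0 a z : #|neg_supp a| = j -> gdeg A a z -> z = 0.
Proof. by move=> aj; apply: (mul_bij_eq0 A_bij (A_eq0 aj) (a := a)). Qed.

Let B_deg0 a y : #|neg_supp a| <> j -> gdeg B a y -> y = 0.
Proof. by move=> aj; apply: (mul_bij_eq0 B_bij (B_eq0 aj) (a := a)). Qed.

Let ext_ker0 (X : extension B A) a (x : X) :
  #|neg_supp a| = j -> gdeg X a x -> ext_proj X x = 0 -> x = 0.
Proof.
move=> aj + /ext_exact [z xE]; rewrite xE => /(grHom_inj_deg (@ext_injP _ _ _ _ X)).
by move=> /(A_deg0 aj) ->; rewrite raddf0.
Qed.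

Let ext_image (X : extension B A) a (x : X) :
  #|neg_supp a| <> j -> gdeg X a x -> exists2 z, gdeg A a z & x = ext_inj X z.
Proof.
move=> aj xa; have /ext_exact [z xE] := B_deg0 aj (ghom_deg (ext_proj X) xa).
by exists z => //; move: xa; rewrite xE => /(grHom_inj_deg (@ext_injP _ _ _ _ X)).
Qed.

Let ext_lift (X : extension B A) a (y : B) :
  gdeg B a y -> exists2 x, gdeg X a x & ext_proj X x = y.
Proof. by have [x <-] := ext_projP X y; apply: grHom_lift_deg. Qed.

(** The division is carried out in [B] and lifted: in degrees with [j] negative entries [ext_proj]
    is injective. *)
Let ext_divX (X : extension B A) a m (x : X) (y : B) :
  #|neg_supp a| = j -> neg_supp (a + mdegZ m) = neg_supp a ->
  gdeg X (a + mdegZ m) x -> gdeg B a y -> 'X_[m] *: y = ext_proj X x ->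
  exists x', [/\ gdeg X a x', ext_proj X x' = y & 'X_[m] *: x' = x].
Proof.
move=> aj am xam ya yx; have [x' x'a x'y] := ext_lift X ya.
exists x'; split=> //; apply/eqP; rewrite -subr_eq0; apply/eqP.
apply: (ext_ker0 (a := a + mdegZ m)); rewrite ?am //.
  by apply: (gradingB (gdegP X)) => //; apply: gdegX.
by rewrite linearB linearZ /= x'y yx subrr.
Qed.

Let neg_supp_incr (a : Zn n) i : a i = -1 -> neg_supp (a + mdegZ U_(i)) = neg_supp a :\ i.
Proof.
move=> ai; apply/setP => l; rewrite !inE !ffunE mnm1E eq_sym.
by have [->|_] := eqVneq l i; [rewrite ai | rewrite addr0].
Qed.

Let card_incr (S : {set 'I_n}) i : #|S| = j -> i \in S -> #|S :\ i| <> j.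
Proof. by move=> <- iS; rewrite (cardsD1 i S) iS; lia. Qed.

(** Divide [e] and [e'] down to degree [b], multiply up to Omega, where [same_maps] applies, and
    bring the conclusion back to [b] and then to [a]. *)
Let maps_step a i (e : E) (e' : E') :
  #|neg_supp a| = j -> a i = -1 -> gdeg E a e -> gdeg E' a e' ->
  ext_proj E e = ext_proj E' e' ->
  exists z, 'X_i *: e = ext_inj E z /\ 'X_i *: e' = ext_inj E' z.
Proof.
move=> aj ai ea e'a ee'.
have [b [m [m' [ma m'S ba bi]]]] := common_lower_degree a.
have {}bi := bi i ai; have bj : #|neg_supp b| = j by rewrite ba.
have bm : neg_supp (b + mdegZ m) = neg_supp b by rewrite ma ba.
have bm' : neg_supp (b + mdegZ m') = neg_supp b by rewrite m'S neg_supp_omega.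
have iS : i \in neg_supp a by rewrite inE ai.
rewrite -ma in ea e'a.
have [_ /(_ (ext_proj E e)) surj] := B_bij bm.
have [y yb ye] := surj (ghom_deg _ ea).
have [f [fb fy fe]] := ext_divX bj bm ea yb ye.
have [f' [f'b f'y f'e']] := ext_divX bj bm e'a yb (etrans ye ee').
have := gdegX m' f'b; have := gdegX m' fb; rewrite m'S => gS g'S.
have [|z [zg zg']] := same_maps aj iS gS g'S.
  by rewrite !linearZ /= fy f'y.
have bij : #|neg_supp (b + mdegZ U_(i))| <> j.
  by rewrite neg_supp_incr // ba; apply: card_incr.
have [z1 z1b z1f] := ext_image bij (gdegX U_(i) fb).
have [z2 z2b z2f'] := ext_image bij (gdegX U_(i) f'b).
have XC (V : lmodType {mpoly k[n]}) p (v : V) : 'X_i *: ('X_[p] *: v) = 'X_[p] *: ('X_i *: v).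
  by rewrite !scalerA mulrC.
have bim' : neg_supp (b + mdegZ U_(i) + mdegZ m') = neg_supp (b + mdegZ U_(i)).
  rewrite addrAC m'S !neg_supp_incr ?neg_supp_omega ?ba //.
  by rewrite ffunE iS.
(* Both become [z] after multiplication by ['X_[m']], which is injective on [A] here: the negative
   support stays [neg_supp a :\ i]. *)
have z12 : z1 = z2.
  apply/eqP; rewrite -subr_eq0; apply/eqP; have [inj _] := A_bij bim'.
  apply: inj; first exact: (gradingB (gdegP A)).
  rewrite scalerBr; apply/eqP; rewrite subr_eq0; apply/eqP.
  transitivity z; first by apply: (@ext_injP _ _ _ _ E); rewrite linearZ /= -z1f -zg XC.
  by apply: (@ext_injP _ _ _ _ E'); rewrite linearZ /= -z2f' -zg' XC.
exists ('X_[m] *: z1); rewrite -fe -f'e' !XC z1f z2f' -z12.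
by rewrite !linearZ.
Qed.

Let maps_mul a m (e : E) (e' : E') :
  #|neg_supp a| = j -> #|neg_supp (a + mdegZ m)| <> j ->
  gdeg E a e -> gdeg E' a e' -> ext_proj E e = ext_proj E' e' ->
  exists z, 'X_[m] *: e = ext_inj E z /\ 'X_[m] *: e' = ext_inj E' z.
Proof.
move=> aj amj ea e'a ee'.
(* Multiplication by a monomial can only shrink the negative support, so a change of cardinality
   means that some index leaves it. *)
have /subsetPn [i ia iam] : ~~ (neg_supp a \subset neg_supp (a + mdegZ m)).
  apply/negP => sub; case: amj; rewrite -aj; apply/eqP; rewrite eqn_leq !subset_leq_card //.
  by apply/subsetP => i; rewrite !inE !ffunE; move: (a i) => x; lia.
(* The factor [x_i^p] raises the entry at [i] to exactly -1; one more [x_i] is handled by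
   [maps_step], and the rest of ['X_[m]] acts inside [A]. *)
rewrite !inE !ffunE in ia iam; pose p := (absz (a i)).-1.
pose b := a + mdegZ (U_(i) *+ p)%MM.
have bi : b i = -1.
  by rewrite /b !ffunE mulmnE mnm1E eqxx /p; move: (a i) ia {iam} => x; lia.
have ba : neg_supp b = neg_supp a.
  apply/setP => l; have [->|li] := eqVneq l i; first by rewrite !inE bi ia.
  by rewrite !inE !ffunE mulmnE mnm1E eq_sym (negPf li) addr0.
have mE : m = ((m - U_(i) *+ p.+1) + U_(i) + U_(i) *+ p)%MM.
  apply/mnmP => l; rewrite !mnmDE mnmBE !mulmnE mnm1E /p.
  have [<-|_] := eqVneq i l; last by rewrite !mul0n subn0 !addn0.
  by move: (a i) ia iam => x; lia.
have [| |z [ze ze']] := @maps_step b i ('X_[U_(i) *+ p] *: e) ('X_[U_(i) *+ p] *: e') _ bi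
  (gdegX _ ea) (gdegX _ e'a).
- by rewrite ba.
- by rewrite !linearZ /= ee'.
exists ('X_[m - U_(i) *+ p.+1] *: z).
have -> : 'X_[m] = 'X_[m - U_(i) *+ p.+1] * 'X_i * 'X_[U_(i) *+ p] :> {mpoly k[n]}.
  by rewrite -!mpolyXD -mE.
by rewrite -!scalerA ze ze' !linearZ.
Qed.

Lemma straight_ext_equiv : ext_equiv E E'.
Proof.
(* The second alternative is allowed in every degree, which lets 0 be related to 0 uniformly; either
   one implies equal images in [B]. *)
pose Rel a (x : E) (y : E') := [/\ gdeg E a x, gdeg E' a y &
  (#|neg_supp a| = j /\ ext_proj E x = ext_proj E' y)
  \/ exists z, x = ext_inj E z /\ y = ext_inj E' z].
have proj_inj (X : extension B A) z : ext_proj X (ext_inj X z) = 0.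
  by apply/ext_exact; exists z.
have Rel_deg a x y : Rel a x y -> gdeg E a x /\ gdeg E' a y by case.
have Rel_proj a x y : Rel a x y -> ext_proj E x = ext_proj E' y.
  by case=> _ _ [[_ ->]|[z [-> ->]]] //; rewrite !proj_inj.
have Rel0 a : Rel a 0 0.
  by split; [exact: grading0 (gdegP E) a | exact: grading0 (gdegP E') a |];
    right; exists 0; rewrite !raddf0.
have RelD a x y x' y' : Rel a x y -> Rel a x' y' -> Rel a (x + x') (y + y').
  move=> R R'; have pE := Rel_proj _ _ _ R; have pE' := Rel_proj _ _ _ R'.
  case: R R' => xa ya [[aj _]|[z [xz yz]]] [x'a y'a R'].
    by split; [exact: gdegD..|left]; rewrite !raddfD /= pE pE'.
  split; [exact: gdegD..|]; case: R' => [[aj _]|[z' [-> ->]]].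
    by left; rewrite !raddfD /= pE pE'.
  by right; exists (z + z'); rewrite xz yz !raddfD.
have RelX a c m x y : Rel a x y ->
    Rel (a + mdegZ m) ((c *: 'X_[m]) *: x) ((c *: 'X_[m]) *: y).
  move=> R; have pE := Rel_proj _ _ _ R; case: R => xa ya R.
  rewrite -mul_mpolyC -!scalerA; split; [exact/gdegC/gdegX..|].
  have [aj|/eqP aj] := eqVneq #|neg_supp (a + mdegZ m)| j.
    by left; rewrite !linearZ /= pE.
  right; suff [z [-> ->]] : exists z, 'X_[m] *: x = ext_inj E z /\ 'X_[m] *: y = ext_inj E' z.
    by exists (c%:MP *: z); rewrite !linearZ.
  (* Only leaving the degrees with [j] negative entries uses the hypothesis on the maps. *)
  case: R => [[aj' _]|[z [-> ->]]]; first exact: maps_mul aj' aj xa ya pE.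
  by exists ('X_[m] *: z); rewrite !linearZ.
have Rel_total a x : gdeg E a x -> exists y, Rel a x y.
  move=> xa; have [aj|/eqP aj] := eqVneq #|neg_supp a| j.
    have [y ya yx] := ext_lift E' (ghom_deg (ext_proj E) xa).
    by exists y; split=> //; left.
  have [z za xz] := ext_image aj xa; exists (ext_inj E' z); split=> //.
    exact: ghom_deg.
  by right; exists z.
have Rel_fun a y : Rel a 0 y -> y = 0.
  case=> _ ya [[aj yE]|[z [z0 ->]]].
    by apply: ext_ker0 aj ya _; rewrite -yE raddf0.
  have -> : z = 0 by apply: (@ext_injP _ _ _ _ E); rewrite -z0 raddf0.
  by rewrite raddf0.
have [f fP] := graded_relation_hom Rel_deg Rel0 RelD RelX Rel_total Rel_fun.
apply: (ext_equiv_hom (f := f)).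
- apply: (@grHom_eq _ _ _ _ (f \o ext_inj E) (ext_inj E')) => a z za /=.
  by apply: (fP a); split; [exact: ghom_deg..|right; exists z].
- apply: (@grHom_eq _ _ _ _ (ext_proj E' \o f) (ext_proj E)) => a x xa /=.
  by have [y R] := Rel_total _ _ xa; rewrite (fP _ _ _ R) (Rel_proj _ _ _ R).
Qed.

End TwoExtensions.

End StraightExtensions.

(** * Dimension count in a subquotient, and the theorem *)

(* [d] independent classes of degree [a] in [N / N'] lift to a basis of [M_a],
   which leaves no room for [N'_a]. *)
Lemma sub_deg_eq0 (k : fieldType) (n : nat) (M : grMod k n) (N' N : grSub M)
    (sN'N : {subset N' <= N}) (a : Zn n) (d : nat) (b : 'I_d -> subquot N' N) :
  has_dim M a d -> (forall i, gdeg (subquot N' N) a (b i)) ->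
  (forall c : 'I_d -> k, \sum_i (c i)%:MP *: b i = 0 -> forall i, c i = 0) ->
  forall z : subGr N', gdeg (subGr N') a z -> z = 0.
Proof.
move=> [w [_ w_span]] b_deg b_free z za.
have /choice [y yP] i : exists y : subGr N,
    gdeg (subGr N) a y /\ subquot_pi N' N y = b i.
  by have [y ya ->] := b_deg i; exists y.
have /choice [C CP] i : exists c : {ffun 'I_d -> k},
    sub_val (y i) = \sum_l (c l)%:MP *: w l.
  by have [c [cE _]] := w_span _ (yP i).1; exists c.
have comb_pi (v : 'I_d -> k) :
    subquot_pi N' N (\sum_i (v i)%:MP *: y i) = \sum_i (v i)%:MP *: b i.
  rewrite raddf_sum; apply: eq_bigr => i _.
  by rewrite -(yP i).2; apply: linearZ.
have comb_val (v : 'I_d -> k) : sub_val (\sum_i (v i)%:MP *: y i) =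
    \sum_l (\sum_i v i * C i l)%:MP *: w l.
  have valZ f (x : subGr N) : sub_val (f *: x) = f *: sub_val x by [].
  rewrite sub_val_sum; under eq_bigr => i _ do rewrite valZ CP scaler_sumr.
  rewrite exchange_big; apply: eq_bigr => l _ /=.
  rewrite raddf_sum /= scaler_suml; apply: eq_bigr => i _.
  by rewrite scalerA mpolyCM.
(* The coordinates of the lifts [y i] in the basis [w]; a relation between the rows would give one
   between the independent classes [b i]. *)
pose Cm : 'M[k]_d := \matrix_(i, l) C i l.
have Cm_mul (v : 'rV_d) l : (v *m Cm) 0 l = \sum_i v 0 i * C i l.
  by rewrite mxE; apply: eq_bigr => i _; rewrite mxE.
have Cm_unit : Cm \in unitmx.
  rewrite -row_free_unit; apply: inj_row_free => v vC; apply/rowP => i; rewrite mxE.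
  apply: (b_free (fun i => v 0 i)); rewrite -comb_pi.
  rewrite -[RHS](raddf0 (subquot_pi N' N)); congr (subquot_pi N' N _).
  apply: val_inj; rewrite /= comb_val big1 // => l _.
  by rewrite -Cm_mul vC mxE mpolyC0 scale0r.
have [c [zE _]] := w_span _ za.
pose v : 'rV_d := (\row_l c l) *m invmx Cm.
have z_comb : sub_incl sN'N z = \sum_i (v 0 i)%:MP *: y i.
  apply: val_inj; rewrite /= zE comb_val; apply: eq_bigr => l _.
  by rewrite -Cm_mul mulmxKV // mxE.
(* The image of [z] in the quotient is 0, and independence of the [b i] applies again. *)
have v0 : forall i, v 0 i = 0.
  apply: (b_free (fun i => v 0 i)); rewrite -comb_pi -z_comb.
  by apply/subquot_exact; exists z.
apply: (sub_hom_inj (sN'N := sN'N)); rewrite raddf0 /= z_comb big1 // => i _.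
by rewrite v0 mpolyC0 scale0r.
Qed.

Theorem proposition3p4 (k : fieldType) (n : nat) (M : grMod k n)
    (M_straight : eps_straight M)
    (F : nat -> grSub M)
    (F_incr : forall j, (1 <= j <= n)%N -> {subset F j.-1 <= F j})
    (F_straight : forall j, (j <= n)%N -> eps_straight (subGr (F j)))
    (F_full : forall x : M, x \in F n)
    (m : {set 'I_n} -> nat)
    (m_dim : forall S : {set 'I_n}, has_dim M (omega S) (m S))
    (F_gr : forall j, (1 <= j <= n)%N ->
       grIso (subquot (F j.-1) (F j))
         (dsumGr (fun S : {S : {set 'I_n} | #|S| == j} =>
            dsumGr (fun _ : 'I_(m (val S)) => local_cohomology k (val S) j))))
    (j : nat) (j_range : (1 <= j <= n)%N)
    (E : extension (subquot (F j.-1) (F j)) (subGr (F j.-1)))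
    (E_maps : forall S : {set 'I_n}, #|S| = j -> forall i, i \in S ->
       forall (e : E) (y : M),
         gdeg E (omega S) e -> gdeg M (omega S) y ->
         ident_quot e y -> ident_sub ('X_i *: e) ('X_i *: y)) :
  ext_class E = ext_class (sub_extension (F_incr j j_range)).
Proof.
have sF := F_incr j j_range; have /andP[j_gt0 jn] := j_range.
have A_bij : mul_bij (subGr (F j.-1)).
  by apply/eps_straight_mul_bij/F_straight/(leq_trans (leq_pred j)).
have B_bij : mul_bij (subquot (F j.-1) (F j)).
  by apply: subquot_mul_bij => //; apply/eps_straight_mul_bij/F_straight.
have [f f_bij] := F_gr j j_range; have f_inj := bij_inj f_bij.
have B_eq0 (T : {set 'I_n}) : #|T| <> j -> forall y,
    gdeg (subquot (F j.-1) (F j)) (omega T) y -> y = 0.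
  move=> Tj y yT; apply: f_inj; rewrite raddf0.
  apply: functional_extensionality_dep => S; apply: functional_extensionality_dep => i.
  apply: (local_cohomology_omega_eq0 (T := T)) => //.
  - exact/eqP/(valP S).
  - by apply/eqP => TS; case: Tj; rewrite TS; apply/eqP/(valP S).
  - exact: (ghom_deg f yT S i).
have A_eq0 (S : {set 'I_n}) : #|S| = j -> forall z,
    gdeg (subGr (F j.-1)) (omega S) z -> z = 0.
  (* The [m S] copies of a nonzero class of degree [omega S] are independent in the quotient, and
     [m S] is already the dimension of [M] in that degree. *)
  move=> Sj; pose u (T : {T : {set 'I_n} | #|T| == j}) :=
    cid2 (local_cohomology_omega k (eqP (valP T)) j_gt0).
  pose D := dsumGr (fun S : {S : {set 'I_n} | #|S| == j} =>
    dsumGr (fun _ : 'I_(m (val S)) => local_cohomology k (val S) j)).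
  (* The nonzero class in copy [l] of the summand [S]. Indices are compared in [nat] because the
     type of [i] depends on [T]. *)
  pose e (l : 'I_(m S)) : D :=
    fun T i => if (val T == S) && (i == l :> nat) then s2val (u T) else 0.
  have [g fK gK] := f_bij.
  apply: (sub_deg_eq0 sF (b := fun l => g (e l)) (m_dim S)) => [l|c c0 l].
    apply: (grHom_inj_deg f_inj); rewrite gK => T i; rewrite /e.
    case: andP => [[/eqP TS _]|_]; last exact: grading0 (gdegP _) _.
    have -> : omega S = omega (val T) by rewrite TS.
    exact: (s2valP (u T)).
  have {}c0 : \sum_i (c i)%:MP *: e i = 0.
    apply: etrans (etrans (congr1 f c0) (raddf0 f)).
    rewrite raddf_sum; apply: eq_bigr => i _.
    by rewrite -[in LHS](gK (e i)); apply/esym/linearZ.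
  have Sj' : #|S| == j by apply/eqP.
  pose S0 : {S : {set 'I_n} | #|S| == j} := Sub S Sj'.
  have := congr1 (fun h : D => h S0 l) c0.
  rewrite !dsum_sumE (bigD1 l) //= big1 ?addr0 => [|l' l'l]; last first.
    rewrite [LHS]/((c l')%:MP *: e l' S0 l) /e /= eqxx /=.
    have /negPf -> : l != l' :> nat by apply: contra l'l => /eqP /ord_inj ->.
    exact: scaler0.
  rewrite [LHS]/((c l)%:MP *: e l S0 l) /e /= !eqxx /= => cu0.
  apply/eqP/negP => /negP c_neq0; case: (s2valP' (u S0)).
  rewrite -[LHS]scale1r -mpolyC1 -(mulVf c_neq0) mpolyCM -scalerA.
  by rewrite [X in _ *: X]cu0 scaler0.
apply: ext_class_eq.
- apply: (straight_ext_equiv A_bij B_bij A_eq0 B_eq0) => S Sj i iS e e' eS e'S ee'.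
  (* The middle term of the second extension is [F j], so [e'] is itself the element of [M]
     identified with [e]. *)
  have [|z zE ze] := E_maps S Sj i iS e (sub_val e') eS e'S; first by exists e'.
  by exists z; split=> //; apply: val_inj.
- apply: (straight_ext_equiv A_bij B_bij A_eq0 B_eq0) => S Sj i iS e' e e'S eS ee'.
  have [|z zE ze] := E_maps S Sj i iS e (sub_val e') eS e'S; first by exists e'.
  by exists z; split=> //; apply: val_inj.
Qed.
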